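(* Let $(X,\mu)$ be a locally compact metric measure space with $\mu$ a Radon measure, and let $f:(X,\mu)\to L^1(Y,\nu)$ be an $L^1_{\mathrm{loc}}$ mapping with associated cut measure $\Sigma$. Let $\mathbb P$ be a locally compact measure space equipped with a Radon measure $\pi$, and let $\Gamma:\mathbb R\times\mathbb P\to X$ be a continuous map such that $\Gamma_*(\mathcal L\times\pi)\le C\mu$ for some $C\in\mathbb R$, where $\mathcal L$ is Lebesgue measure on $\mathbb R$. Write $\Gamma_p=\Gamma(\cdot,p)$. Then the following are equivalent: (i) For $\pi$-a.e. $p\in\mathbb P$, the composition $f\circ\Gamma_p:\mathbb R\to L^1(Y,\nu)$ is a geodesic map, i.e. there is a full measure subset $Z_p\subset\mathbb R$ such that for all $z_1\le z_2\le z_3$ in $Z_p$, with $h=f\circ\Gamma_p$, $$\|h(z_1)-h(z_3)\|_{L^1}=\|h(z_1)-h(z_2)\|_{L^1}+\|h(z_2)-h(z_3)\|_{L^1}.$$ (ii) $\Sigma$-a.e. cut $E$ is $\Gamma$-monotone.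
   Context: $(Y,\nu)$ is a $\sigma$-finite measure space. An $L^1_{\mathrm{loc}}$ mapping $f:X\to L^1(Y,\nu)$ is a measurable map, defined up to $\mu$-null sets, whose norm is integrable on compact sets. (The bound $\Gamma_*(\mathcal L\times\pi)\le C\mu$ makes $f\circ\Gamma_p$ well defined a.e. for $\pi$-a.e. $p$.) A cut in $X$ is an equivalence class of measurable subsets of $X$ modulo $\mu$-null sets. $\mathrm{Cut}(X)$ is the set of cuts, viewed via $E\mapsto\chi_E$ as a subset of $L^1_{\mathrm{loc}}(X)$ with the induced topology. A cut measure is a Borel measure $\Sigma$ on $\mathrm{Cut}(X)$ with $\int_{\mathrm{Cut}(X)}\mu(E\cap K)\,d\Sigma(E)<\infty$ for every compact $K\subset X$. For a cut measure $\Sigma$ there is a $\Sigma\times\mu$-measurable function $\Phi:\mathrm{Cut}(X)\times X\to\{0,1\}$, unique up to null sets, such that for $\Sigma$-a.e. $E$ one has $\Phi(E,x)=\chi_E(x)$ for $\mu$-a.e. $x$. The cut metric is $$d_\Sigma(x_1,x_2)=\int_{\mathrm{Cut}(X)}|\Phi(E,x_1)-\Phi(E,x_2)|\,d\Sigma(E),$$ defined for $x_1,x_2$ in a full measure subset of $X$. A cut measure $\Sigma$ is associated with $f$ if there is a full measure subset $Z\subset X$ such that $\|f(x_1)-f(x_2)\|_{L^1}=d_\Sigma(x_1,x_2)$ for all $x_1,x_2\in Z$; such a $\Sigma$ always exists. A measurable subset of $\mathbb R$ is monotone if it agrees up to a null set with a measurable set which is connected and has connected complement. A measurable subset (or cut)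 $E\subset X$ is $\Gamma$-monotone if for $\pi$-a.e. $p\in\mathbb P$ the set $\Gamma_p^{-1}(E)\subset\mathbb R$ is measurable and monotone; this does not depend on the representative of the cut.
   Formalization: The measure μ on X is additionally assumed σ-finite (automatic when X is separable or σ-compact); without this the product Σ×μ and its Fubini theorem break down and the equivalence can fail. *)

(* Defs.v *)
From HB Require Import structures.
From mathcomp Require Import all_boot all_order all_algebra.
From mathcomp Require Import all_classical all_reals all_analysis.
From mathcomp Require Import measurable_realfun.

Set Implicit Arguments.
Unset Strict Implicit.
Unset Printing Implicit Defensive.

Import Order.TTheory GRing.Theory Num.Theory.
Import numFieldNormedType.Exports.

Local Open Scope classical_set_scope.
Local Open Scope ring_scope.

(* The library's measurable types are pointed, hence so is a metric space on
   which a measure is to be put. *)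
#[short(type="pmetricType")]
HB.structure Definition PointedMetric (R : numDomainType) :=
  {T of Metric R T & isPointed T}.

Definition borel (T : ptopologicalType) := g_sigma_algebraType (@open T).
HB.instance Definition _ (T : ptopologicalType) := Measurable.on (borel T).

(* In a Hausdorff space compact sets are Borel and the clauses [measurable K]
   are automatic. *)
Definition radon (R : realType) (T : ptopologicalType)
    (m : {measure set (borel T) -> \bar R}) : Prop :=
  [/\ forall K : set (borel T), measurable K -> @compact T K -> (m K < +oo)%E,
      forall A : set (borel T), measurable A ->
        m A = ereal_inf [set m U | U in [set U | @open T U /\ A `<=` U]] &
      forall U : set (borel T), @open T U ->
        m U = ereal_sup [set m K | K in
          [set K : set (borel T) | [/\ measurable K, @compact T K & K `<=` U]]]].

Section L1.
Context d (Y : measurableType d) (R : realType).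
Variable nu : {measure set Y -> \bar R}.

Definition L1norm (g : LspaceType1 nu) : \bar R :=
  'N[nu]_1[ (fun y => (g y)%:E) ]%E.

Definition L1dist (g h : LspaceType1 nu) : \bar R :=
  'N[nu]_1[ (fun y => (g y - h y)%:E) ]%E.

Definition L1open (U : set (LspaceType1 nu)) : Prop :=
  forall g, U g ->
    exists e : R, 0 < e /\ [set h | (L1dist g h < e%:E)%E] `<=` U.

End L1.

Section cuts.
Context (R : realType) (X : pmetricType R).
Variable mu : {measure set (borel X) -> \bar R}.

(* Classes of measurable functions with the topology of L^1 convergence on
   compact sets.  When mu is finite on compact sets, the locally integrable
   classes form the subspace L^1_loc, and it contains every characteristic
   function: the topology it induces on cuts is the one induced from here. *)
Definition L0 : Type := {mfun_ mu, borel X >-> measurableTypeR R}.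
HB.instance Definition _ := Choice.on L0.
Definition L0_fun (f : L0) : borel X -> measurableTypeR R :=
  (f : {mfun_ mu, borel X >-> measurableTypeR R}).
Coercion L0_fun : L0 >-> Funclass.

Definition L1loc_ball (K : set (borel X)) (f : L0) (e : R) : set L0 :=
  [set g : L0 | (\int[mu]_(x in K) `| f x - g x |%:E < e%:E)%E].

Definition L1loc_open (U : set L0) : Prop :=
  forall f, U f -> exists K : set (borel X), exists e : R,
    [/\ @compact X K, 0 < e & L1loc_ball K f e `<=` U].

Lemma compact_borel (K : set (borel X)) : @compact X K -> measurable K.
Proof.
move=> cK; rewrite -[K]setCK; apply: measurableC; apply: sub_sigma_algebra.
by apply: closed_openC; exact: (@compact_closed X K (@metric_hausdorff R X) cK).
Qed.

Lemma L1loc_ballS (K K' : set (borel X)) (f : L0) (e e' : R) :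
  measurable K -> measurable K' -> K `<=` K' -> e' <= e ->
  L1loc_ball K' f e' `<=` L1loc_ball K f e.
Proof.
move=> mK mK' KK' ee' g; rewrite /L1loc_ball/= => h.
apply: (@lt_le_trans _ _ e'%:E); last by rewrite lee_fin.
apply: le_lt_trans h; apply: ge0_subset_integral => //.
apply/measurable_EFinP; apply: measurableT_comp => //.
apply: measurable_funB; apply: measurable_funTS;
  exact: (@measurable_funPT _ _ _ _ (repr (_ : {mfun_ mu, borel X >-> measurableTypeR R}))).
Qed.

Lemma L1loc_openT : L1loc_open setT.
Proof. by move=> f _; exists set0, 1; split => //; exact: compact0. Qed.

Lemma L1loc_openI : setI_closed L1loc_open.
Proof.
move=> U V oU oV f [/oU[K [e [cK e0 KU]]] /oV[K' [e' [cK' e'0 KV]]]].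
have cKK' : @compact X (K `|` K') by exact: compactU.
exists (K `|` K'), (Num.min e e'); split => //.
  by rewrite lt_min e0 e'0.
move=> g gb; split.
- apply: KU; apply: L1loc_ballS gb; [exact: compact_borel|exact: compact_borel
    |exact: subsetUl|by rewrite ge_min lexx].
- apply: KV; apply: L1loc_ballS gb; [exact: compact_borel|exact: compact_borel
    |exact: subsetUr|by rewrite ge_min lexx orbT].
Qed.

Lemma L1loc_open_bigU (I : Type) (F : I -> set L0) :
  (forall i, L1loc_open (F i)) -> L1loc_open (\bigcup_i F i).
Proof.
move=> oF f [i _ /oF[K [e [cK e0 KF]]]]; exists K, e; split => //.
by move=> g /KF Fg; exists i.
Qed.

HB.instance Definition _ :=
  isOpenTopological.Build L0 L1loc_openT L1loc_openI L1loc_open_bigU.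

Definition borel_set : Type :=
  {E : set (borel X) | E \in (measurable : set (set (borel X)))}.
HB.instance Definition _ := Choice.on borel_set.

Definition null_diff (E F : borel_set) : bool :=
  `[< mu (val E `+` val F) = 0%E >].

Lemma null_diff_refl : reflexive null_diff.
Proof. by move=> E; apply/asboolP; rewrite setYK measure0. Qed.

Lemma null_diff_sym : symmetric null_diff.
Proof. by move=> E F; rewrite /null_diff setYC. Qed.

Lemma null_diff_trans : transitive null_diff.
Proof.
move=> F E G /asboolP EF /asboolP FG; apply/asboolP.
have mY (A B : borel_set) : measurable (val A `+` val B).
  case: A B => A mA [B mB] /=; rewrite !inE in mA mB.
  by rewrite setY_def; apply: measurableU; exact: measurableD.
apply: measure_negligible => //.
apply: (@negligibleS _ _ _ _ ((val E `+` val F) `|` (val F `+` val G))).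
  move=> x; rewrite !setY_def /=.
  have [] := pselect (val F x); tauto.
by apply: negligibleU; apply/negligibleP.
Qed.

Canonical null_diff_equiv :=
  EquivRel null_diff null_diff_refl null_diff_sym null_diff_trans.

Local Open Scope quotient_scope.

Definition Cut : Type := {eq_quot null_diff}.
HB.instance Definition _ := Choice.on Cut.
HB.instance Definition _ := EqQuotient.on Cut.

Lemma set0_borel_set :
  (set0 : set (borel X)) \in (measurable : set (set (borel X))).
Proof. by rewrite inE. Qed.

HB.instance Definition _ :=
  isPointed.Build Cut (\pi_Cut (exist _ set0 set0_borel_set : borel_set)).

(* A representative of the cut. *)
Definition cut_set (E : Cut) : set (borel X) := val (repr E).

Lemma measurable_cut_set (E : Cut) : measurable (cut_set E).
Proof. by have := valP (repr E); rewrite inE. Qed.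

Definition cut_char_fun (E : Cut) : borel X -> measurableTypeR R :=
  \1_(cut_set E).

Lemma measurable_cut_char_fun (E : Cut) : measurable_fun setT (cut_char_fun E).
Proof. by apply: measurable_indic; exact: measurable_cut_set. Qed.

HB.instance Definition _ (E : Cut) :=
  isMeasurableFun.Build _ _ _ _ (cut_char_fun E) (measurable_cut_char_fun E).

Definition cut_char (E : Cut) : L0 :=
  \pi_({mfun_ mu, borel X >-> measurableTypeR R})
    (cut_char_fun E : {mfun borel X >-> measurableTypeR R}).

HB.instance Definition _ := Topological.copy Cut (initial_topology cut_char).

Definition cut_measure (Sigma : {measure set (borel Cut) -> \bar R}) : Prop :=
  forall K : set (borel X), @compact X K ->
    (\int[Sigma]_E mu (cut_set E `&` K) < +oo)%E.

Definition cut_evaluation (Sigma : {measure set (borel Cut) -> \bar R})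
    (Phi : borel Cut * borel X -> bool) : Prop :=
  measurable_fun setT Phi /\
  {ae Sigma, forall E, {ae mu, forall x, Phi (E, x) = (x \in cut_set E)}}.

Definition cut_metric (Sigma : {measure set (borel Cut) -> \bar R})
    (Phi : borel Cut * borel X -> bool) (x1 x2 : X) : \bar R :=
  (\int[Sigma]_E `|(Phi (E, x1))%:R - (Phi (E, x2))%:R|%:E)%E.

Section maps_to_L1.
Context d (Y : measurableType d).
Variable nu : {measure set Y -> \bar R}.

Definition L1loc_map (f : X -> LspaceType1 nu) : Prop :=
  (forall U, L1open U -> measurable (f @^-1` U : set (borel X))) /\
  (forall K : set (borel X), @compact X K ->
    (\int[mu]_(x in K) L1norm (f x) < +oo)%E).

(* [Phi] is unique up to null sets, so that d_Sigma is well defined on a set of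
   full measure and the choice of [Phi] is immaterial. *)
Definition associated (f : X -> LspaceType1 nu)
    (Sigma : {measure set (borel Cut) -> \bar R}) : Prop :=
  exists2 Phi, cut_evaluation Sigma Phi &
    exists2 Z : set (borel X), mu.-negligible (~` Z) &
      forall x1 x2, Z x1 -> Z x2 ->
        L1dist (f x1) (f x2) = cut_metric Sigma Phi x1 x2.

End maps_to_L1.

End cuts.

Definition geodesic (R : realType) d (Y : measurableType d)
    (nu : {measure set Y -> \bar R}) (h : R -> LspaceType1 nu) : Prop :=
  exists2 Z : set R, lebesgue_measure.-negligible (~` Z) &
    forall z1 z2 z3, Z z1 -> Z z2 -> Z z3 -> z1 <= z2 <= z3 ->
      L1dist (h z1) (h z3) = (L1dist (h z1) (h z2) + L1dist (h z2) (h z3))%E.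

Definition monotone_set (R : realType) (A : set R) : Prop :=
  exists2 B : set R, lebesgue_measure.-negligible (A `+` B) &
    [/\ measurable B, connected B & connected (~` B)].

Definition Gamma_monotone (R : realType) (X P : ptopologicalType)
    (pi : {measure set (borel P) -> \bar R}) (Gamma : R * P -> X)
    (E : set X) : Prop :=
  {ae pi, forall p,
    measurable ((fun t => Gamma (t, p)) @^-1` E : set R) /\
    monotone_set ((fun t => Gamma (t, p)) @^-1` E)}.

(* Main.v *)
Require Import Defs.
From HB Require Import structures.
From mathcomp Require Import all_boot all_order all_algebra.
From mathcomp Require Import all_classical all_reals all_analysis.
From mathcomp Require Import measurable_realfun.

Set Implicit Arguments.
Unset Strict Implicit.
Unset Printing Implicit Defensive.

Import Order.TTheory GRing.Theory Num.Theory.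
Import numFieldNormedType.Exports.

Local Open Scope classical_set_scope.
Local Open Scope ring_scope.

(** The cut metric is an integral of elementary pseudometrics: on the points of
a curve Gamma_p, the distance d_Sigma is the integral over the cuts E of
|w_E(s) - w_E(t)|, where w_E(t) tells whether Gamma_p(t) lies in E.  Each
integrand satisfies the triangle inequality, and for r < s < t the inequality
is strict at E exactly when w_E takes one value at r and t and the other one at
s.  The integrals being finite, the equality required of a geodesic at (r, s, t)
therefore holds if and only if almost every cut avoids that pattern
([cut_dist_additive]); and a boolean function that avoids it everywhere is the
indicator of a ray, of the empty set or of the line, that is, of a monotone
set.  What remains is to exchange quantifiers: the exceptional cuts depend on
(r, s, t) in (i), and the exceptional curves depend on the cut in (ii).  Below,
rays include the empty set and the line.

For a fixed curve ([geodesic_ray_like]) one exchange in a single real variable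
is enough.  If the curve is a geodesic, choose a countable dense set D of good
times.  For every good time t, almost every cut avoids the pattern on D and t
together, this being countably many conditions; so almost every cut does it for
almost every t, and then sandwiching t between points of D shows that the cut
is a ray up to a null set ([unswitching_ray_like]).  Conversely a cut that is a
ray up to a null set avoids the pattern at all of its settled times, those
whose side of the ray agrees with the cut; almost every time is settled for a
given cut, hence almost every time is settled for almost every cut, and these
times form the full measure set of the geodesic ([ray_like_unswitching]).

Being a ray up to a null set is expressed by the vanishing of countably many
Lebesgue measures, so that it defines a measurable set of pairs (E, p)
([measurable_ray_like]) and Fubini's theorem exchanges the two variables
([ae_swap]).  Fubini's theorem needs sigma-finiteness, which neither pi nor
Sigma is assumed to have.  Cover X by countably many sets of finite measure:
every curve spends a positive time in one of them, and the bound on the image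
measure makes these times integrable in p, so that pi is sigma-finite
([curve_family_sigma_finite]).  A cut that is not null has positive mass in one
of countably many compact sets, and these masses are integrable; so Sigma is
sigma-finite away from the null cut, which is a single point
([cut_measure_null_sigma_finite]).  That point may have infinite mass, but only
null sets matter here, and for them an infinite mass at an atom can be replaced
by a finite one ([atom_null_sigma_finite]). *)

(** * Exchanging almost everywhere quantifiers *)

Section null_sigma_finite.
Context (R : realType).

Lemma ae_measure0 d (T : measurableType d) (m : {measure set T -> \bar R})
    (A : set T) :
  measurable A -> {ae m, forall x, A x} <-> m (~` A) = 0%E.
Proof. by move=> mA; apply: negligibleP; exact: measurableC. Qed.

Lemma ae_forall_countable d (T : measurableType d)
    (m : {measure set T -> \bar R}) (I : countType) (Q : I -> T -> Prop) :
  (forall i, {ae m, forall x, Q i x}) ->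
  {ae m, forall x, forall i, Q i x}.
Proof.
move=> aeQ; pose Q' n x := if unpickle n is Some i then Q i x else True.
have : {ae m, forall x, forall n, Q' n x}.
  by apply: ae_foralln => n; rewrite /Q'; case: unpickle => // ; exact: aeW.
by apply: filterS => x Q'x i; have := Q'x (pickle i); rewrite /Q' pickleK.
Qed.

(** Both sides say that the product measure of the complement of [A] vanishes,
computed by integrating over one variable or the other. *)
Lemma ae_swap_sigma_finite d1 d2 (T1 : measurableType d1)
    (T2 : measurableType d2) (m1 : {sigma_finite_measure set T1 -> \bar R})
    (m2 : {sigma_finite_measure set T2 -> \bar R}) (A : set (T1 * T2)) :
  measurable A -> {ae m1, forall x, {ae m2, forall y, A (x, y)}} ->
  {ae m2, forall y, {ae m1, forall x, A (x, y)}}.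
Proof.
move=> mA aeA; pose B := ~` A.
have mB : measurable B by exact: measurableC.
have m2x x : m2 (~` [set y | A (x, y)]) = (m2 \o xsection B) x.
  by rewrite /= xsectionE.
have m1y y : m1 (~` [set x | A (x, y)]) = (m1 \o ysection B) y.
  by rewrite /= ysectionE.
have mAx x : measurable [set y | A (x, y)].
  by have := measurable_xsection x mA; rewrite xsectionE.
have mAy y : measurable [set x | A (x, y)].
  by have := measurable_ysection y mA; rewrite ysectionE.
have : (\int[m1]_x `|(m2 \o xsection B) x| = 0)%E.
  apply/ae_eq_integral_abs => //; first exact: measurable_fun_xsection.
  apply: filterS aeA => x /(ae_measure0 _ (mAx x)) h _.
  exact: etrans (esym (m2x x)) h.
under eq_integral do rewrite gee0_abs//.
have := indic_fubini_tonelli m1 m2 mB.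
rewrite indic_fubini_tonelli_FE// indic_fubini_tonelli_GE// => -> int0.
have /ae_eq_integral_abs : (\int[m2]_y `|(m1 \o ysection B) y| = 0)%E.
  by under eq_integral do rewrite gee0_abs//.
move=> /(_ measurableT (measurable_fun_ysection _ mB)).
apply: filterS => y /(_ Logic.I) yB; apply/(ae_measure0 _ (mAy y)).
exact: etrans (m1y y) yB.
Qed.

(** The hypothesis of Fubini's theorem, weakened to what a statement about null
sets can see: it allows atoms of infinite mass. *)
Definition null_sigma_finite d (T : measurableType d)
    (m : {measure set T -> \bar R}) :=
  exists m' : {sigma_finite_measure set T -> \bar R},
    forall A, measurable A -> m A = 0%E <-> m' A = 0%E.

Lemma ae_null_equiv d (T : measurableType d) (m m' : {measure set T -> \bar R})
    (Q : T -> Prop) :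
  (forall A, measurable A -> m A = 0%E <-> m' A = 0%E) ->
  {ae m, forall x, Q x} <-> {ae m', forall x, Q x}.
Proof.
by move=> mm'; split=> -[A [mA A0 AQ]]; exists A; split => //; exact/mm'.
Qed.

Lemma ae_swap d1 d2 (T1 : measurableType d1) (T2 : measurableType d2)
    (m1 : {measure set T1 -> \bar R}) (m2 : {measure set T2 -> \bar R})
    (A : set (T1 * T2)) :
  null_sigma_finite m1 -> null_sigma_finite m2 -> measurable A ->
  {ae m1, forall x, {ae m2, forall y, A (x, y)}} <->
  {ae m2, forall y, {ae m1, forall x, A (x, y)}}.
Proof.
move=> [n1 m1E] [n2 m2E] mA; pose A' := (fun z => (z.2, z.1)) @^-1` A.
have mA' : measurable A'.
  rewrite -[A']setTI.
  have mswap : measurable_fun setT (fun z : T2 * T1 => (z.2, z.1)).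
    by apply: measurable_fun_pair.
  exact: mswap.
split=> h.
- suff : {ae n2, forall y, {ae n1, forall x, A (x, y)}}.
    move/(ae_null_equiv _ m2E); apply: filterS => y.
    by move/(ae_null_equiv _ m1E).
  apply: ae_swap_sigma_finite => //; apply/(ae_null_equiv _ m1E).
  by apply: filterS h => x /(ae_null_equiv _ m2E).
- suff : {ae n1, forall x, {ae n2, forall y, A (x, y)}}.
    move/(ae_null_equiv _ m1E); apply: filterS => y.
    by move/(ae_null_equiv _ m2E).
  apply: (@ae_swap_sigma_finite _ _ _ _ n2 n1 A') => //.
  apply/(ae_null_equiv _ m2E).
  by apply: filterS h => x /(ae_null_equiv _ m1E).
Qed.

Lemma sigma_finite_null_sigma_finite d (T : measurableType d)
    (m : {measure set T -> \bar R}) :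
  sigma_finite setT m -> null_sigma_finite m.
Proof.
move=> mfin.
pose H1 := isSFinite.Build _ _ _ m (sfinite_measure_sigma_finite mfin).
pose H2 := isSigmaFinite.Build _ _ _ m mfin.
pose m' := HB.pack_for {sigma_finite_measure set T -> \bar R}
  (Measure.sort m) H1 H2.
by exists m'.
Qed.

(** The sets where [f n] is at least [1 / (k + 1)] have finite measure, by
Markov's inequality. *)
Lemma finite_cover_of_integrals d (T : measurableType d)
    (m : {measure set T -> \bar R}) (f : (T -> \bar R)^nat) :
  (forall n, measurable_fun setT (f n)) -> (forall n x, (0 <= f n x)%E) ->
  (forall n, (\int[m]_x f n x < +oo)%E) ->
  sigma_finite [set x | exists n, (0 < f n x)%E] m.
Proof.
move=> mf f0 intf.
pose F n := let: (i, k) := (odflt (0, 0)%N (unpickle n)) in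
  [set x | (k.+1%:R^-1%:E <= f i x)%E].
exists F.
  apply/seteqP; split=> [x /= [i fi0]|x [n _]]; last first.
    rewrite /F; case: (odflt _ _) => i k /= fx; exists i.
    by apply: lt_le_trans fx; rewrite lte_fin.
  have [k kf] : exists k : nat, (k.+1%:R^-1%:E <= f i x)%E.
    have [foo|ffin] := eqVneq (f i x) +oo%E.
      by exists 0%N; rewrite foo leey.
    have fE : f i x = (fine (f i x))%:E.
      by rewrite fineK// ge0_fin_numE// ltey.
    move: fi0; rewrite fE lte_fin => r0; exists (Num.truncn (fine (f i x))^-1).
    rewrite lee_fin invf_ple ?posrE// ?ltr0n//.
    exact/ltW/truncnS_gt.
  by exists (pickle (i, k)) => //=; rewrite /F pickleK.
move=> n; rewrite /F; case: (odflt _ _) => i k.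
have mF : measurable [set x | (k.+1%:R^-1%:E <= f i x)%E].
  by rewrite -[X in measurable X]setTI; exact: emeasurable_fun_c_infty.
split => //; have k0 : (0 < k.+1%:R^-1 :> R) by [].
have := le_integral_abse m measurableT (mf i) k0.
under eq_integral do rewrite gee0_abs//.
under eq_set do rewrite gee0_abs//.
rewrite setTI => /le_lt_trans /(_ (intf i)).
move=> mlt; rewrite ltey; apply: contraTneq mlt => ->.
by rewrite gt0_muley ?lte_fin.
Qed.

(** Null sets do not change when the mass of the atom [a] is replaced by [1],
or by [0] if it was [0]. *)
Lemma atom_null_sigma_finite d (T : measurableType d)
    (m : {measure set T -> \bar R}) (a : T) :
  sigma_finite (~` [set a]) m -> null_sigma_finite m.
Proof.
move=> [F aF Ffin].
have ma : measurable [set a].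
  rewrite -[X in measurable X]setCK aF; apply: measurableC.
  by apply: bigcupT_measurable => i; have [] := Ffin i.
pose c : {nonneg R} := NngNum (ler0n R (m [set a] != 0%E)).
pose n : {measure set T -> \bar R} :=
  measure_add (mrestr m (measurableC ma)) (mscale c (dirac a)).
have nE A : n A = (m (A `&` ~` [set a]) + c%:num%:E * \d_a A)%E.
  exact: measure_addE.
suff [n' nn'] : null_sigma_finite n.
  exists n' => A mA; rewrite -nn'// nE.
  have mAa : measurable (A `&` ~` [set a]).
    by apply: measurableI => //; exact: measurableC.
  have [Aa|Aa] := pselect (A a); last first.
    rewrite /dirac indicE memNset// mule0 adde0.
    suff -> : A `&` ~` [set a] = A by [].
    by apply/setIidPl => x Ax xa; apply: Aa; rewrite -xa.
  rewrite /dirac indicE mem_set// mule1.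
  have -> : m A = (m (A `&` ~` [set a]) + m [set a])%E.
    rewrite -measureU//; last by rewrite -setIA setICl setI0.
    congr (m _); apply/seteqP; split=> x /=; last by case=> [[]//|->].
    by have [->|xa] := pselect (x = a); [right|left].
  rewrite /c /=; case: eqVneq => [->|ma0]; rewrite ?adde0//=.
  have mAa0 := measure_ge0 m (A `&` ~` [set a]).
  by split=> /eqP;
    rewrite padde_eq0 ?measure_ge0// ?(negbTE ma0) ?onee_eq0 andbF.
apply: sigma_finite_null_sigma_finite.
exists (fun i => if i is j.+1 then F j else [set a]).
  apply/seteqP; split=> // x _.
  have [->|xa] := pselect (x = a); first by exists 0%N.
  have : (~` [set a]) x by [].
  by rewrite aF => -[i _ Fx]; exists i.+1.
have c_fin A : (c%:num%:E * \d_a A < +oo)%E.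
  by rewrite /dirac indicE -EFinM ltry.
case=> [|i]; rewrite nE; split.
- by [].
- by rewrite setICr measure0 add0e c_fin.
- by have [] := Ffin i.
- have [mFi Fi] := Ffin i; rewrite lte_add_pinfty// (le_lt_trans _ Fi)//.
  by apply: le_measure; rewrite ?inE//; apply: measurableI => //;
    exact: measurableC.
Qed.

End null_sigma_finite.

(** * Monotone subsets of the line *)

(** The line carries its measurable structure under another name, which hides
this filter from inference. *)
#[local] Instance ae_lebesgue_filter (R : realType) :
  Filter (nbhs (almost_everywhere (@lebesgue_measure R))) :=
  ae_filter_ringOfSetsType (@lebesgue_measure R).

Section monotone_functions.
Context (R : realType).
Implicit Types (D : set R) (w : R -> bool).
Local Notation L := (@lebesgue_measure R).

Lemma ae_meets_itv (Q : R -> Prop) (x y : R) : {ae L, forall t, Q t} ->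
  x < y -> exists2 z, Q z & x < z < y.
Proof.
move=> aeQ xy; apply: contrapT => nz.
have : L.-negligible `]x, y[%classic.
  apply: negligibleS aeQ => z /=; rewrite in_itv/= => xzy Qz.
  by apply: nz; exists z.
move=> /negligibleP /=.
rewrite lebesgue_measure_itv/= lte_fin xy => /(_ (measurable_itv _))/eqP.
by rewrite -EFinB eqe subr_eq0 gt_eqF.
Qed.

(** For the indicator of a cut, this is equality in the triangle inequality for
ordered triples of points of [D]. *)
Definition unswitching D w := forall x y z, D x -> D y -> D z ->
  x < y -> y < z -> w x = w z -> w y = w x.

Lemma unswitching_sub D D' w :
  D' `<=` D -> unswitching D w -> unswitching D' w.
Proof. by move=> DD' uw x y z /DD' Dx /DD' Dy /DD' Dz; exact: uw. Qed.

(** An increase and a decrease of [w] on [D] would contain, among their four end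
points, a forbidden triple.  The conclusion says that once [w] has left the
value [b] it does not come back. *)
Lemma unswitching_monotone D w : unswitching D w ->
  exists b, forall x y, D x -> D y -> x < y -> w x = ~~ b -> w y = ~~ b.
Proof.
move=> uw.
have [|nd] := pselect (exists x y, [/\ D x, D y, x < y, w x & ~~ w y]).
  move=> [x [y [Dx Dy xy wx wy]]]; exists true => s t Ds Dt st /= ws.
  apply/negbTE/negP => wt; move: wx ws wy wt.
  case: (ltgtP x s) => [xs|sx|->]; last by move=> ->.
  - move=> wx ws wy wt; have := uw _ _ _ Dx Ds Dt xs st.
    by rewrite wx wt ws => /(_ erefl).
  - move=> wx ws wy wt; have := uw _ _ _ Ds Dx Dy sx xy.
    by rewrite wx ws (negbTE wy) => /(_ erefl).
exists false => x y Dx Dy xy wx; apply: contrapT => /negP wy.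
by apply: nd; exists x, y.
Qed.

Definition const_below w (q : R) (b : bool) :=
  {ae L, forall t, t < q -> w t = b}.

Definition const_above w (q : R) (b : bool) :=
  {ae L, forall t, q < t -> w t = b}.

(** Up to a null set, the set where [w] differs from [b] is empty, the line or a
ray unbounded above.  Only rational thresholds and null sets occur, so that the
condition depends measurably on parameters and ignores changes of [w] on null
sets. *)
Definition ray_like w := exists b, forall q : rat,
  const_below w (ratr q) b \/ const_above w (ratr q) (~~ b).

Lemma ray_like_ae w w' : {ae L, forall t, w t = w' t} ->
  ray_like w -> ray_like w'.
Proof.
move=> ww' [b wb]; exists b => q; have [wq|wq] := wb q; [left|right].
- by apply: filterS2 ww' wq => t <-.
- by apply: filterS2 ww' wq => t <-.
Qed.

(** Only one variable point is tested at a time against the fixed set [D]: every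
[t] is sandwiched between points of [D] arbitrarily close to it, and if [w]
agrees at these, it has the same value at [t]. *)
Lemma unswitching_ray_like D w :
  (forall x y : R, x < y -> exists2 z, D z & x < z < y) ->
  {ae L, forall t, unswitching (D `|` [set t]) w} -> ray_like w.
Proof.
move=> dD uw.
have uwD : unswitching D w.
  have [t ut] : exists t, unswitching (D `|` [set t]) w.
    by have [t ut _] := ae_meets_itv uw (@ltr01 R); exists t.
  exact: unswitching_sub ut.
have [b wb] := unswitching_monotone uwD; exists b => q.
have [[x [Dx xq wx]]|nx] :=
    pselect (exists x, [/\ D x, x < ratr q & w x = ~~ b]).
- right; apply: filterS uw => t ut qt.
  have [z Dz /andP[tz _]] : exists2 z, D z & t < z < t + 1.
    by apply: dD; rewrite ltrDl.
  have xt := lt_trans xq qt.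
  have wz : w z = ~~ b by apply: wb wx => //; exact: lt_trans tz.
  by rewrite -wx; apply: (ut x t z) => //; [left|right|left|rewrite wx wz].
- left; apply: filterS uw => t ut tq.
  have wE x : D x -> x < ratr q -> w x = b.
    move=> Dx xq; apply: contrapT => wx; apply: nx; exists x; split => //.
    by move: wx; case: (w x) b {wb} => -[].
  have [z Dz /andP[tz zq]] := dD _ _ tq.
  have [y Dy /andP[_ yt]] : exists2 y, D y & t - 1 < y < t.
    by apply: dD; rewrite ltrBlDr ltrDl.
  rewrite -(wE y)//; last exact: lt_trans tq.
  apply: (ut y t z) => //; [by left|by right|by left|].
  by rewrite !wE//; exact: lt_trans tq.
Qed.

(** If [w] is almost everywhere constant on a half-line containing [t], then [w]
takes that value at [t].  Rational end points make this countably many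
conditions on [t]. *)
Definition settled w (t : R) := forall q : rat * bool,
  (t < ratr q.1 -> const_below w (ratr q.1) q.2 -> w t = q.2) /\
  (ratr q.1 < t -> const_above w (ratr q.1) q.2 -> w t = q.2).

Lemma ae_settled w : {ae L, forall t, settled w t}.
Proof.
apply: ae_forall_countable => -[q b] /=.
have [wb|wb] := pselect (const_below w (ratr q) b);
have [wa|wa] := pselect (const_above w (ratr q) b).
- by apply: filterS2 wb wa => t ht ht'; split=> [/ht|/ht'].
- by apply: filterS wb => t ht; split=> [/ht|_ /wa].
- by apply: filterS wa => t ht; split=> [_ /wb|/ht].
- by apply: aeW => t; split.
Qed.

(** Two rationals separating the three points suffice: the ray may switch before
the first rational, between them or after the second, and at most once. *)
Lemma ray_like_unswitching w : ray_like w -> unswitching (settled w) w.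
Proof.
move=> [b wb] x y z sx sy sz xy yz wxz.
have [q /itvP qxy] := rat_in_itvoo xy; have [r /itvP ryz] := rat_in_itvoo yz.
have [wq|wq] := wb q; last first.
  rewrite wxz (sy (q, ~~ b)).2 ?qxy// (sz (q, ~~ b)).2//=.
  by rewrite (lt_trans _ yz)// qxy.
have wx : w x = b by rewrite (sx (q, b)).1 ?qxy.
have [wr|wr] := wb r.
  by rewrite wx (sy (r, b)).1 ?ryz.
by move: wxz; rewrite wx (sz (r, ~~ b)).2 ?ryz//; case: b {wb wq wx wr}.
Qed.

(** The switching point is located through the rationals, which leaves out the
point itself: the exceptional set [E] of the proof has at most one element. *)
Lemma ray_like_monotone_set w : ray_like w -> monotone_set [set t | w t].
Proof.
move=> [b wb].
(* up to a null set, the ray on which [w] differs from [b] *)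
pose B : set R :=
  [set t | exists2 q : rat, ratr q < t & ~ const_below w (ratr q) b].
have upB x y : x < y -> B x -> B y.
  by move=> xy [q qx nq]; exists q => //; exact: lt_trans xy.
have iB : is_interval B.
  by apply/is_intervalPlt => x y Bx _ z /andP[xz _]; exact: upB Bx.
have iCB : is_interval (~` B).
  apply/is_intervalPlt => x y _ CBy z /andP[_ zy] Bz; apply: CBy.
  exact: upB Bz.
have mB : measurable B by exact: is_interval_measurable.
pose E : set R := [set t | ~ B t /\ forall q : rat, t < ratr q ->
  ~ const_below w (ratr q) b].
have E0 : L.-negligible E.
  have [[a Ea]|nE] := pselect (E !=set0); last first.
    by apply: negligibleS (negligible_set0 L) => x Ex; apply: nE; exists x.
  exists [set a]; split; [exact: measurable_set1|exact: lebesgue_measure_set1|].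
  have Elt x y : E x -> E y -> x < y -> False.
    move=> [_ Ex] [By _] xy; have [q /itvP qxy] := rat_in_itvoo xy.
    by apply: By; exists q; [rewrite qxy|apply: Ex; rewrite qxy].
  move=> x Ex /=; case: (ltgtP x a) => // xa; exfalso.
    exact: Elt Ex Ea xa.
  exact: Elt Ea Ex xa.
have aeB : {ae L, forall t, w t = ~~ b <-> B t}.
  have aeE : {ae L, forall t, ~ E t}.
    by apply: negligibleS E0 => t /= /contrapT.
  apply: filterS2 (ae_settled w) aeE => t st nEt; split=> [wt|[q qt nq]].
    apply: contrapT => nBt; apply: nEt; split => // q tq qb.
    by have := (st (q, b)).1 tq qb; rewrite wt /=; case: (b).
  by have [//|qa] := wb q; exact: (st (q, ~~ b)).2 qt qa.
clear E0 E upB; clearbody B; case: b {wb} aeB => /= aeB.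
- exists (~` B); last first.
    split; [exact: measurableC|exact/connected_intervalP|].
    by rewrite setCK; exact/connected_intervalP.
  rewrite setY_def; apply: negligibleS aeB => t /= h h'.
  case: h => -[]; first by move=> wt /contrapT/h'; rewrite wt.
  by move=> nBt /negP/negbTE/h'.
- exists B; last first.
    by split; [|exact/connected_intervalP|exact/connected_intervalP].
  rewrite setY_def; apply: negligibleS aeB => t /= h h'.
  by case: h => -[]; [move=> /h'|move=> /h'].
Qed.

(** The indicator of a connected set with connected complement never switches
back, at any three points of the line. *)
Lemma monotone_set_ray_like w : monotone_set [set t | w t] -> ray_like w.
Proof.
move=> [B wB [_ /connected_intervalP/is_intervalPlt iB]].
move=> /connected_intervalP/is_intervalPlt iCB.
move: wB; rewrite setY_def => wB.
apply: (@ray_like_ae (fun t => t \in B)).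
  apply: negligibleS wB => t /= wt.
  have [tB|tB] := pselect (B t).
    by right; split => // wt'; apply: wt; rewrite wt' mem_set.
  left; split => //; move: wt; rewrite memNset//.
  by case: (w t) => // /(_ erefl).
apply: (@unswitching_ray_like setT).
  move=> x y xy; exists ((x + y) / 2) => //.
  by rewrite !midf_lt.
apply: aeW => t x y z _ _ _ xy yz.
have [Bx|Bx] := pselect (B x).
  rewrite (mem_set Bx) => /esym/set_mem Bz; apply/mem_set.
  by apply: (iB x z) => //; rewrite xy.
rewrite (memNset Bx) => /esym/negbT; rewrite notin_setE => Bz.
by apply/memNset/(iCB x z) => //; rewrite xy.
Qed.

End monotone_functions.

(** * Measurable dependence on the cut *)

Section parametrized_boolean_functions.
Context (R : realType) d (T : measurableType d).
Local Notation L := (@lebesgue_measure R).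

Lemma measurable_imply d' (S : measurableType d') (P Q : set S) :
  measurable P -> measurable Q -> measurable [set x | P x -> Q x].
Proof.
move=> mP mQ; rewrite (_ : [set x | _] = ~` P `|` Q).
  by apply: measurableU => //; exact: measurableC.
apply/seteqP; split=> x /=; last by case.
by have [Px|Px] := pselect (P x); [move=> /(_ Px)|]; [right|left].
Qed.

Lemma measurable_forall d' (S : measurableType d') (I : countType)
    (P : I -> set S) :
  (forall i, measurable (P i)) -> measurable [set x | forall i, P i x].
Proof.
move=> mP; rewrite (_ : [set x | _] = \bigcap_n
    (if unpickle n is Some i then P i else setT)).
  by apply: bigcap_measurableType => n _; case: unpickle.
apply/seteqP; split=> x /= Px.
  by move=> n _; case: unpickle => [i|//]; exact: Px.
by move=> i; have := Px (pickle i) Logic.I; rewrite pickleK.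
Qed.

Lemma measurable_bool d' (S : measurableType d') (b : S -> bool) :
  measurable_fun setT b -> measurable [set x | b x].
Proof.
by move=> mb; rewrite -[X in measurable X]setTI; exact: mb.
Qed.

Lemma measurable_eq_bool d' (S : measurableType d') (b c : S -> bool) :
  measurable_fun setT b -> measurable_fun setT c ->
  measurable [set x | b x = c x].
Proof.
move=> mb mc; have mbc := measurable_fun_pair mb mc.
rewrite (_ : [set x | _] = (fun x => (b x, c x)) @^-1` [set (true, true)] `|`
  (fun x => (b x, c x)) @^-1` [set (false, false)]).
  have mtt (a a' : bool) : measurable [set (a, a')].
    rewrite (_ : [set (a, a')] = [set a] `*` [set a']); last first.
      by apply/seteqP; split=> -[x y] /= => [[-> ->]|[-> ->]].
    exact: measurableX.
  by apply: measurableU; rewrite -[X in measurable X]setTI; exact: mbc.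
apply/seteqP; split=> x /=.
  by move=> ->; case: (c x); [left|right].
by case=> -[-> ->].
Qed.

Lemma measurable_ae d' (S : measurableType d')
    (m : {sigma_finite_measure set S -> \bar R}) (A : set (T * S)) :
  measurable A -> measurable [set x | {ae m, forall y, A (x, y)}].
Proof.
move=> mA; have mAx x : measurable [set y | A (x, y)].
  by have := measurable_xsection x mA; rewrite xsectionE.
rewrite (_ : [set x | _] = (m \o xsection (~` A)) @^-1` [set 0%E]).
  rewrite -[X in measurable X]setTI; apply: measurable_fun_xsection => //.
  exact: measurableC.
apply/seteqP; split=> x /=; rewrite xsectionE => h.
  exact/(ae_measure0 _ (mAx x)).
exact/(ae_measure0 _ (mAx x)).
Qed.

Variable w : T * R -> bool.
Hypothesis mw : measurable_fun setT w.

Let msnd : measurable_fun setT (snd : T * R -> R).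
Proof. exact: measurable_snd. Qed.

Lemma measurable_const_below q b :
  measurable [set x | const_below (fun t => w (x, t)) q b].
Proof.
apply: (@measurable_ae _ _ L [set z | z.2 < q -> w z = b]).
apply: measurable_imply; last exact: measurable_eq_bool.
by apply: measurable_bool; exact: measurable_fun_ltr.
Qed.

Lemma measurable_const_above q b :
  measurable [set x | const_above (fun t => w (x, t)) q b].
Proof.
apply: (@measurable_ae _ _ L [set z | q < z.2 -> w z = b]).
apply: measurable_imply; last exact: measurable_eq_bool.
by apply: measurable_bool; exact: measurable_fun_ltr.
Qed.

Lemma measurable_ray_like :
  measurable [set x | ray_like (fun t => w (x, t))].
Proof.
pose A b (q : rat) := [set x | const_below (fun t => w (x, t)) (ratr q) b] `|`
  [set x | const_above (fun t => w (x, t)) (ratr q) (~~ b)].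
have mA b : measurable [set x | forall q, A b q x].
  apply: measurable_forall => q; apply: measurableU.
    exact: measurable_const_below.
  exact: measurable_const_above.
rewrite (_ : [set x | _] = [set x | forall q, A true q x] `|`
  [set x | forall q, A false q x]); first exact: measurableU.
apply/seteqP; split=> x /=; first by move=> [[] h]; [left|right].
by case=> h; [exists true|exists false].
Qed.

Lemma measurable_settled :
  measurable [set z : T * R | settled (fun t => w (z.1, t)) z.2].
Proof.
apply: measurable_forall => -[q b] /=.
have mfst (A : set T) : measurable A -> measurable [set z : T * R | A z.1].
  by move=> mA; have := @measurable_fst _ _ T R measurableT A mA; rewrite setTI.
have mwb : measurable [set z : T * R | w (z.1, z.2) = b].
  rewrite (_ : [set z | _] = [set z | w z = b]).
    exact: measurable_eq_bool.
  by apply/seteqP; split=> -[].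
apply: measurableI; apply: measurable_imply.
- by apply: measurable_bool; exact: measurable_fun_ltr.
- apply: measurable_imply => //.
  exact: mfst (measurable_const_below (ratr q) b).
- by apply: measurable_bool; exact: measurable_fun_ltr.
- apply: measurable_imply => //.
  exact: mfst (measurable_const_above (ratr q) b).
Qed.

End parametrized_boolean_functions.

(** * Geodesics and the cut metric along a curve *)

Section cut_distance.
Context (R : realType) d (T : measurableType d).
Variable m : {measure set T -> \bar R}.

Definition cut_dist (u v : T -> bool) : \bar R :=
  (\int[m]_x `|(u x)%:R - (v x)%:R|%:E)%E.

Let measurable_natbool (u : T -> bool) : measurable_fun setT u ->
  measurable_fun setT (fun x => (u x)%:R : R).
Proof.
move=> mu; rewrite (_ : (fun _ => _) = (fun x => if u x then 1 else 0)).
  exact: measurable_fun_ifT.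
by apply/funext => x; case: (u x).
Qed.

(** The defect of the triangle inequality is the integral of a nonnegative
function, [2] on the bad set and [0] elsewhere; finiteness of the left-hand side
allows cancelling it. *)
Lemma cut_dist_additive (u v s : T -> bool) :
  measurable_fun setT u -> measurable_fun setT v -> measurable_fun setT s ->
  (cut_dist u s < +oo)%E ->
  cut_dist u s = (cut_dist u v + cut_dist v s)%E <->
  {ae m, forall x, u x = s x -> v x = u x}.
Proof.
move=> mu mv ms us_fin.
have mdist (u' v' : T -> bool) :
    measurable_fun setT u' -> measurable_fun setT v' ->
    measurable_fun setT (fun x => `|(u' x)%:R - (v' x)%:R : R|%:E).
  move=> mu' mv'; apply/measurable_EFinP; apply: measurableT_comp => //.
  by apply: measurable_funB; exact: measurable_natbool.
pose k x : bool := (u x != s x) || (v x == u x).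
have mbeq (b c : T -> bool) : measurable_fun setT b -> measurable_fun setT c ->
    measurable_fun setT (fun x => b x == c x).
  move=> mb mc; apply: (measurable_fun_bool true); rewrite setTI.
  rewrite (_ : _ @^-1` _ = [set x | b x = c x]).
    exact: measurable_eq_bool.
  by apply/seteqP; split=> x /= /eqP.
have mk : measurable_fun setT k.
  by apply: measurable_or; [apply: measurable_neg|]; exact: mbeq.
pose g x : \bar R := ((~~ k x)%:R * 2)%:E.
have mg : measurable_fun setT g.
  apply/measurable_EFinP/measurable_funM => //.
  exact/measurable_natbool/measurable_neg.
have g0 x : (0 <= g x)%E by rewrite lee_fin mulr_ge0.
have E : (cut_dist u v + cut_dist v s = cut_dist u s + \int[m]_x g x)%E.
  rewrite /cut_dist -!ge0_integralD//; do ?exact: mdist.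
  apply: eq_integral => x _; rewrite /g /k -!EFinD; congr EFin.
  by case: (u x); case: (v x); case: (s x);
    rewrite /= ?subrr ?subr0 ?sub0r ?normrN ?normr0 ?normr1 ?mul0r ?addr0
      ?add0r ?mul1r.
have kE x : (u x = s x -> v x = u x) <-> k x.
  by rewrite /k; case: (u x); case: (v x); case: (s x); split=> //= /(_ erefl).
have aeE0 : {ae m, forall x, u x = s x -> v x = u x} <->
    (\int[m]_x g x = 0)%E.
  have -> : (\int[m]_x g x = \int[m]_x `|g x|%E)%E.
    by apply: eq_integral => x _; rewrite gee0_abs.
  split=> [aek|/(ae_eq_integral_abs _ measurableT mg)].
    apply/ae_eq_integral_abs => //; apply: filterS aek => x /kE + _.
    by rewrite /g => ->; rewrite mul0r.
  apply: filterS => x /(_ Logic.I) gx; apply/kE; move: gx; rewrite /g.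
  by case: (k x) => // -[] /eqP; rewrite mul1r pnatr_eq0.
rewrite E; split=> [h|/aeE0 ->]; last by rewrite adde0.
apply/aeE0.
have us_num : cut_dist u s \is a fin_num.
  by rewrite ge0_fin_numE//; apply: integral_ge0 => x _; rewrite lee_fin.
have : (cut_dist u s - cut_dist u s =
    cut_dist u s + \int[m]_x g x - cut_dist u s)%E by rewrite -h.
by rewrite subee// addeAC subee// add0e.
Qed.

End cut_distance.

Section geodesic_of_cuts.
Context (R : realType) d (T : measurableType d).
Variables (m : {measure set T -> \bar R}) (w : T * R -> bool).
Hypothesis msf : null_sigma_finite m.
Hypothesis mw : measurable_fun setT w.
Local Notation L := (@lebesgue_measure R).

Let Lsf : null_sigma_finite L.
Proof. exact/sigma_finite_null_sigma_finite/sigma_finiteT. Qed.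

Let mw_at t : measurable_fun setT (fun x => w (x, t)).
Proof. exact: measurableT_comp. Qed.

(** The countable dense set consists of one point of [Z] in each rational
interval; adjoining [t] to it keeps the family of conditions countable, so that
the exceptional set of parameters depends on [t] alone. *)
Lemma ae_unswitching_ray_like (Z : set R) : L.-negligible (~` Z) ->
  (forall r s t, Z r -> Z s -> Z t -> r < s -> s < t ->
    {ae m, forall x, w (x, r) = w (x, t) -> w (x, s) = w (x, r)}) ->
  {ae m, forall x, ray_like (fun t => w (x, t))}.
Proof.
move=> Z0 Zw.
have aeZ : {ae L, forall t, Z t} by exact: Z0.
have [z0 Zz0 _] := ae_meets_itv aeZ (@ltr01 R).
have /choice [g gP] : forall q : rat * rat, exists t, Z t /\
    (ratr q.1 < ratr q.2 :> R -> (ratr q.1 < t < ratr q.2)).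
  move=> q; have [q12|q12] := ltP (ratr q.1 : R) (ratr q.2).
    by have [z Zz qz] := ae_meets_itv aeZ q12; exists z.
  by exists z0.
(* enumerates the dense set together with [t] *)
pose h (t : R) (i : option (rat * rat)) := if i is Some q then g q else t.
have mh i : measurable_fun setT (fun z : T * R => h z.2 i).
  by case: i => [q|]; [exact: measurable_cst|exact: measurable_snd].
have mwh i : measurable_fun setT (fun z : T * R => w (z.1, h z.2 i)).
  apply: measurableT_comp => //; apply: measurable_fun_pair => //.
pose I : countType :=
  (option (rat * rat) * option (rat * rat) * option (rat * rat))%type.
pose U (z : T * R) := forall i : I,
  h z.2 i.1.1 < h z.2 i.1.2 -> h z.2 i.1.2 < h z.2 i.2 ->
  w (z.1, h z.2 i.1.1) = w (z.1, h z.2 i.2) ->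
  w (z.1, h z.2 i.1.2) = w (z.1, h z.2 i.1.1).
have mU : measurable [set z | U z].
  apply: measurable_forall => -[[i j] k] /=.
  do 2 (apply: measurable_imply; first by apply: measurable_bool;
    exact: measurable_fun_ltr).
  by apply: measurable_imply; exact: measurable_eq_bool.
have aeU : {ae m, forall x, {ae L, forall t, U (x, t)}}.
  apply/(ae_swap msf Lsf mU).
  apply: filterS aeZ => t Zt; apply: ae_forall_countable => -[[i j] k].
  have Zh l : Z (h t l) by case: l => [q|//]; have [] := gP q.
  have [ij|ij] := ltP (h t i) (h t j); last first.
    by apply: aeW.
  have [jk|jk] := ltP (h t j) (h t k); last first.
    by apply: aeW.
  by apply: filterS (Zw _ _ _ (Zh i) (Zh j) (Zh k) ij jk) => x.
apply: filterS aeU => x aeU.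
apply: (@unswitching_ray_like _ (range g)).
  move=> x0 y0 xy; have [p /itvP px] := rat_in_itvoo xy.
  have py : ratr p < y0 by rewrite px.
  have [q /itvP qp] := rat_in_itvoo py.
  have [_ /(_ _)/andP[|gp gq]] := gP (p, q); first by rewrite qp.
  exists (g (p, q)); first by exists (p, q).
  by rewrite (lt_trans _ gp) ?px//= (lt_trans gq)// qp.
apply: filterS aeU => t Ut.
have hP s : (range g `|` [set t]) s -> exists i, s = h t i.
  by case=> [[q _ <-]|->]; [exists (Some q)|exists None].
by move=> r s u /hP[i ->] /hP[j ->] /hP[k ->]; exact: (Ut (i, j, k)).
Qed.

(** The equivalence for one curve, [T] being the space of cuts and [w (E, t)]
telling whether the curve is in [E] at time [t].  The full measure set of the
geodesic is made of the times that are settled for almost every cut. *)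
Lemma geodesic_ray_like (D : R -> R -> \bar R) (Z : set R) :
  L.-negligible (~` Z) ->
  (forall s t, Z s -> Z t ->
    D s t = cut_dist m (fun x => w (x, s)) (fun x => w (x, t))) ->
  (forall s t, (D s t < +oo)%E) ->
  (exists2 Z', L.-negligible (~` Z') & forall z1 z2 z3, Z' z1 -> Z' z2 ->
    Z' z3 -> z1 <= z2 <= z3 -> D z1 z3 = (D z1 z2 + D z2 z3)%E) <->
  {ae m, forall x, ray_like (fun t => w (x, t))}.
Proof.
move=> Z0 DE Dfin; have DP z1 z2 z3 : Z z1 -> Z z2 -> Z z3 ->
    D z1 z3 = (D z1 z2 + D z2 z3)%E <->
    {ae m, forall x, w (x, z1) = w (x, z3) -> w (x, z2) = w (x, z1)}.
  move=> Zz1 Zz2 Zz3; rewrite !DE//; apply: cut_dist_additive => //.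
  by rewrite -DE.
split=> [[Z' Z'0 Z'D]|aer].
  apply: (@ae_unswitching_ray_like (Z `&` Z')).
    by rewrite setCI; exact: negligibleU.
  move=> r s t [Zr Z'r] [Zs Z's] [Zt Z't] rs st.
  by apply/DP => //; apply: Z'D => //; rewrite !ltW.
have /(ae_swap msf Lsf (measurable_settled mw)) aes :
    {ae m, forall x, {ae L, forall t, settled (fun t => w (x, t)) t}}.
  by apply: aeW => x; exact: ae_settled.
exists (Z `&` [set t | {ae m, forall x, settled (fun t => w (x, t)) t}]).
  by rewrite setCI; exact: negligibleU.
move=> z1 z2 z3 [Zz1 s1] [Zz2 s2] [Zz3 s3] /andP[z12 z23].
apply/DP => //; move: z12 z23; rewrite !le_eqVlt => /predU1P[<- _|z12].
  by apply: aeW.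
move=> /predU1P[<-|z23]; first by apply: aeW.
apply: filterS2 aer (filterI s1 (filterI s2 s3)) => x rx [] s1x [] s2x s3x.
exact: (ray_like_unswitching rx) s1x s2x s3x z12 z23.
Qed.

End geodesic_of_cuts.

(** * Sigma-finiteness of cut measures *)

Section radon_exhaustion.
Context (R : realType) (X : pmetricType R).
Variable mu : {measure set (borel X) -> \bar R}.

(** Each piece of a sigma-finite cover lies in an open set of finite measure,
which is filled by compact sets up to arbitrarily small measure. *)
Lemma radon_compact_exhaustion : radon mu -> sigma_finite setT mu ->
  exists2 K : (set (borel X))^nat, (forall n, @compact X (K n)) &
    mu.-negligible (~` \bigcup_n K n).
Proof.
move=> [_ outer inner] [A AT Afin].
have /choice[U UP] : forall n, exists U : set (borel X),
    [/\ @open X U, A n `<=` U & (mu U < +oo)%E].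
  move=> n; have [mA muA] := Afin n.
  move: (muA); rewrite (outer _ mA) => /ereal_inf_lt[_ [U [oU AU] <-] muU].
  by exists U.
have /choice[K KP] : forall nk : nat * nat, exists K : set (borel X),
    [/\ @compact X K, K `<=` U nk.1 &
        (mu (U nk.1 `\` K) <= nk.2.+1%:R^-1%:E)%E].
  move=> [n k] /=; have [oU _ muU] := UP n.
  have mU : measurable (U n) by exact: sub_sigma_algebra.
  have muUfin : mu (U n) \is a fin_num by rewrite ge0_fin_numE.
  have k0 : 0 < k.+1%:R^-1 :> R by [].
  move: muUfin; rewrite (inner _ oU) => muUfin.
  have [_ [K [mK cK KU] <-]] := ub_ereal_sup_adherent k0 muUfin.
  rewrite -(inner _ oU) => muK; exists K; split => //.
  move: muUfin; rewrite -(inner _ oU) => muUfin.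
  rewrite measureD//.
  rewrite setIidr//.
  have muKfin : mu K \is a fin_num.
    by rewrite ge0_fin_numE// (le_lt_trans _ muU)// le_measure ?inE.
  by rewrite leeBlDr// addeC -leeBlDr// ltW.
exists (fun n => if unpickle n is Some nk then K nk else set0).
  move=> n; case: unpickle => [nk|]; first by have [] := KP nk.
  exact: compact0.
apply: (@negligibleS _ _ _ _ (\bigcup_n (U n `\` \bigcup_k K (n, k)))).
  move=> x nKx; have [n _ Ax] : (\bigcup_n A n) x by rewrite -AT.
  exists n => //; split; first by have [_ AU _] := UP n; exact: AU.
  move=> [k _ Kx]; apply: nKx; exists (pickle (n, k)) => //.
  by rewrite pickleK.
apply: negligible_bigcup => n.
have mK nk : measurable (K nk) by have [cK _ _] := KP nk; exact: compact_borel.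
have mU : measurable (U n) by have [oU _ _] := UP n; exact: sub_sigma_algebra.
have mUK : measurable (U n `\` \bigcup_k K (n, k)).
  by apply: measurableD => //; exact: bigcupT_measurable.
apply/negligibleP => //; apply/eqP; rewrite -measure_le0.
apply/lee_addgt0Pr => e e0; rewrite add0e.
have [_ _ muUK] := KP (n, Num.truncn e^-1).
apply: (@le_trans _ _ (mu (U n `\` K (n, Num.truncn e^-1)))).
  rewrite le_measure ?inE//; first exact: measurableD.
  by apply: setDS => x Kx; exists (Num.truncn e^-1).
apply: le_trans muUK _; rewrite lee_fin invf_ple ?posrE//.
exact/ltW/truncnS_gt.
Qed.

End radon_exhaustion.

Section cut_measures.
Context (R : realType) (X : pmetricType R).
Variable mu : {measure set (borel X) -> \bar R}.

(** The local L^1 norm may be infinite on [L0].  Where it is, any function at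
finite distance has infinite norm as well. *)
Lemma open_L1loc_norm_gt (K : set (borel X)) (c : R) : @compact X K ->
  open [set f : L0 mu | (c%:E < \int[mu]_(x in K) `|f x|%:E)%E].
Proof.
move=> cK; suff : L1loc_open [set f : L0 mu |
  (c%:E < \int[mu]_(x in K) `|f x|%:E)%E] by [].
have mK : measurable K := compact_borel cK.
have mL0 (f : L0 mu) : measurable_fun K f.
  by apply: measurable_funTS; exact: (@measurable_funPT _ _ _ _
    (repr (f : {mfun_ mu, borel X >-> measurableTypeR R}))).
have tri (f g : L0 mu) : (\int[mu]_(x in K) `|f x|%:E <=
    \int[mu]_(x in K) `|f x - g x|%:E + \int[mu]_(x in K) `|g x|%:E)%E.
  have mfg : measurable_fun K (fun x => `|f x - g x|%:E).
    apply/measurable_EFinP; apply: measurableT_comp => //.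
    by apply: measurable_funB; exact: mL0.
  have mg : measurable_fun K (fun x => `|g x|%:E).
    by apply/measurable_EFinP; apply: measurableT_comp => //; exact: mL0.
  rewrite -ge0_integralD//; apply: ge0_le_integral => //.
  - by apply/measurable_EFinP; apply: measurableT_comp => //; exact: mL0.
  - exact: emeasurable_funD.
  - move=> x Kx; rewrite -EFinD lee_fin.
    by rewrite -[X in `|X| <= _](subrK (g x)) ler_normD.
move=> f /= cf.
have [foo|ffin] := eqVneq (\int[mu]_(x in K) `|f x|%:E)%E +oo%E.
  exists K, 1; split => // g /=; rewrite /L1loc_ball /= => fg1.
  have := tri f g; rewrite foo leye_eq => /eqP.
  case: (\int[mu]_(x in K) `|g x|%:E)%E => [r||];
    last by case: (integral _ _ _) fg1.
    by move=> h; move: fg1; case: (integral _ _ _) h.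
  by rewrite ltry.
have f0 : (0 <= \int[mu]_(x in K) `|f x|%:E)%E.
  by apply: integral_ge0 => x _; rewrite lee_fin.
have fE : (\int[mu]_(x in K) `|f x|%:E)%E =
    (fine (\int[mu]_(x in K) `|f x|%:E)%E)%:E.
  by rewrite fineK// ge0_fin_numE// ltey.
move: cf fE; set r := fine _ => cf fE; move: cf; rewrite fE lte_fin => cr.
exists K, (r - c); split => //; first by rewrite subr_gt0.
move=> g; rewrite /L1loc_ball /= => fg.
have := tri f g; rewrite fE => /le_lt_trans h.
rewrite ltNge; apply/negP => gc.
have : (r%:E < (r - c)%:E + c%:E)%E.
  apply: h; apply: lte_leD => //.
  rewrite fin_numElt (le_lt_trans gc (ltry _)) andbT.
  by rewrite (lt_le_trans (ltNy0))// integral_ge0.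
by rewrite -EFinD subrK ltxx.
Qed.

Lemma integral_cut_char (E : Cut mu) (K : set (borel X)) : measurable K ->
  (\int[mu]_(x in K) `|cut_char E x|%:E)%E = mu (cut_set E `&` K).
Proof.
move=> mK; rewrite -(integral_indic mu mK (measurable_cut_set E)).
have aeE : {ae mu, forall x, cut_char E x = \1_(cut_set E) x :> R}.
  have : (\pi_({mfun_ mu, borel X >-> measurableTypeR R})
    (repr (cut_char E : {mfun_ mu, borel X >-> measurableTypeR R}))
    = \pi_({mfun_ mu, borel X >-> measurableTypeR R})
    (cut_char_fun E : {mfun borel X >-> measurableTypeR R}))%qT.
    by rewrite reprK.
  move=> /eqmodP /asboolP; apply: filterS => x; exact.
apply: ge0_ae_eq_integral => //.
- apply/measurable_EFinP; apply: measurableT_comp => //.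
  by apply: measurable_funTS; exact: (@measurable_funPT _ _ _ _
    (repr (cut_char E : {mfun_ mu, borel X >-> measurableTypeR R}))).
- apply/measurable_EFinP; apply: measurable_funTS.
  by apply: measurable_indic; exact: measurable_cut_set.
- by apply: filterS aeE => x -> _; rewrite ger0_norm.
Qed.

Lemma measurable_cut_mass (K : set (borel X)) : @compact X K ->
  measurable_fun setT (fun E : borel (Cut mu) => mu (cut_set E `&` K)).
Proof.
move=> cK; apply: (measurability _ (ErealGenOInfty.measurableE R)).
move=> _ [_ [c ->] <-]; rewrite setTI; apply: sub_sigma_algebra.
rewrite preimage_itvoy.
rewrite (_ : [set E | _] = @cut_char _ _ mu @^-1`
    [set f : L0 mu | (c%:E < \int[mu]_(x in K) `|f x|%:E)%E]).
  apply: open_comp; last exact: open_L1loc_norm_gt.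
  by move=> E _; exact: initial_continuous.
by apply/seteqP; split=> E /=; rewrite integral_cut_char//;
  exact: compact_borel.
Qed.

(** The distinguished point of [Cut mu] is the class of the empty set, the only
cut of measure zero. *)
Lemma cut_mass_gt0 (K : (set (borel X))^nat) :
  (forall n, @compact X (K n)) -> mu.-negligible (~` \bigcup_n K n) ->
  [set E : Cut mu | exists n, (0 < mu (cut_set E `&` K n))%E] =
  ~` [set point].
Proof.
move=> cK K0; have mK n : measurable (K n) by exact: compact_borel.
apply/seteqP; split=> E /=.
  move=> [n En] E0; move: En; rewrite E0.
  suff -> : mu (cut_set (point : Cut mu) `&` K n) = 0%E by rewrite ltxx.
  have : (repr (point : Cut mu) = exist _ set0 (set0_borel_set X)
      %[mod (Cut mu)])%qT.
    by rewrite reprK.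
  move=> /eqmodP /asboolP; rewrite setY0 => p0.
  apply/eqP; rewrite -measure_le0 -p0.
  apply: le_measure; rewrite ?inE; last exact: subIsetl.
  - by apply: measurableI => //; exact: measurable_cut_set.
  - exact: measurable_cut_set.
move=> nE; apply: contrapT => nK; apply: nE.
rewrite -[E]reprK; apply/eqmodP/asboolP; rewrite setY0.
apply: measure_negligible; first exact: measurable_cut_set.
apply: (@negligibleS _ _ _ _
    ((\bigcup_n (cut_set E `&` K n)) `|` ~` \bigcup_n K n)).
  move=> x Ex; have [[n _ Kx]|] := pselect ((\bigcup_n K n) x); last by right.
  by left; exists n.
apply: negligibleU => //; apply: negligible_bigcup => n.
apply/negligibleP; first by apply: measurableI => //; exact: measurable_cut_set.
apply: contrapT => /eqP En; apply: nK; exists n.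
by rewrite lt0e En measure_ge0.
Qed.

Lemma cut_measure_null_sigma_finite
    (Sigma : {measure set (borel (Cut mu)) -> \bar R}) :
  radon mu -> sigma_finite setT mu -> cut_measure Sigma ->
  null_sigma_finite Sigma.
Proof.
move=> rmu smu cS; have [K cK K0] := radon_compact_exhaustion rmu smu.
apply: (@atom_null_sigma_finite _ _ (borel (Cut mu)) Sigma (point : Cut mu)).
rewrite -(cut_mass_gt0 cK K0); apply: finite_cover_of_integrals => //.
- by move=> n; exact: measurable_cut_mass.
- by move=> n; exact: cS.
Qed.

End cut_measures.

(** * Families of curves *)

Section curve_family.
Context (R : realType) (X P : ptopologicalType).
Variables (mu : {measure set (borel X) -> \bar R}).
Variables (pi : {measure set (borel P) -> \bar R}).
Variables (Gamma : R * P -> X) (C : R).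
Hypothesis cGamma : continuous Gamma.
Hypothesis Gamma_le : forall A : set (borel X), measurable A ->
  ((@lebesgue_measure R \x^ pi) (Gamma @^-1` A) <= C%:E * mu A)%E.
Local Notation L := (@lebesgue_measure R).
Local Notation RP := (measurableTypeR R * borel P)%type.

(** The Borel sets of [R * P] may be more than the product sigma-algebra, so
that continuity alone is not enough.  The countable base of the line makes the
preimage of an open set a countable union of open rectangles. *)
Lemma measurable_curve_family :
  measurable_fun setT (Gamma : RP -> borel X).
Proof.
apply: measurability => // _ [W oW <-]; rewrite setTI.
pose V (q : rat * rat) : set P := interior [set y | forall t : R,
  ratr q.1 < t < ratr q.2 -> W (Gamma (t, y))].
pose F n : set RP := if unpickle n is Some q then
  `]ratr q.1, ratr q.2[%classic `*` V q else set0.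
rewrite (_ : _ @^-1` _ = \bigcup_n F n).
  apply: bigcupT_measurable => n; rewrite /F; case: unpickle => // q.
  apply: measurableX; first exact: measurable_itv.
  by apply: sub_sigma_algebra; exact: open_interior.
apply/seteqP; split=> -[t y] /=; last first.
  move=> [n _]; rewrite /F; case: unpickle => // q [] /=.
  by rewrite in_itv /= => tq /interior_subset; exact.
move=> Wty; have : nbhs (t, y) (Gamma @^-1` W).
  by apply: cGamma; exact: open_nbhs_nbhs.
move=> [[A B] /= [At By] AB].
have [e /= e0 eA] := (nbhs_ballP _ _).1 At.
have [r /itvP rt] : exists q : rat, ratr q \in `](t - e), t[.
  by apply: rat_in_itvoo; rewrite ltrBlDr ltrDl.
have [s /itvP st] : exists q : rat, ratr q \in `]t, (t + e)[.
  by apply: rat_in_itvoo; rewrite ltrDl.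
exists (pickle (r, s)); [exact: Logic.I|rewrite /F pickleK; split => /=].
  by rewrite in_itv /= rt st.
apply: filterS By => y' By' u /andP[ru us]; apply: (AB (u, y')); split => //=.
apply: eA; rewrite /ball /= ltr_distlC.
by rewrite (lt_trans _ ru) ?rt//= (lt_trans us)// st.
Qed.

Lemma measurable_curve (p : P) :
  measurable_fun setT ((fun t => Gamma (t, p)) : R -> borel X).
Proof. exact: (measurableT_comp measurable_curve_family). Qed.

(** The bound on the image measure sends null sets of [X] to null sets of
[R * P], and a null set of the product is null on almost every curve. *)
Lemma ae_curve_family (Q : X -> Prop) : {ae mu, forall x, Q x} ->
  {ae pi, forall p, {ae L, forall t, Q (Gamma (t, p))}}.
Proof.
move=> [A [mA A0 QA]].
have mGA : measurable (Gamma @^-1` A : set RP).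
  by rewrite -[X in measurable X]setTI; exact: measurable_curve_family.
have /ae_eq_integral_abs :
    (\int[pi]_p `|(L \o ysection (Gamma @^-1` A : set RP)) p| = 0)%E.
  under eq_integral do rewrite gee0_abs//.
  apply/eqP; rewrite eq_le integral_ge0// andbT.
  by have := Gamma_le mA; rewrite A0 mule0.
move=> /(_ measurableT (measurable_fun_ysection _ mGA)).
apply: filterS => p /(_ Logic.I) /= Lp.
exists (ysection (Gamma @^-1` A : set RP) p); split => //.
  exact: measurable_ysection.
by move=> t nQ; rewrite ysectionE; exact: QA.
Qed.

(** The function that sends [p] to the time spent by the curve in [A n] has
finite integral, and for each [p] it is positive for some [n], since these
times cover a line. *)
Lemma curve_family_sigma_finite : sigma_finite setT mu -> sigma_finite setT pi.
Proof.
move=> [A AT Afin].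
have mGA n : measurable (Gamma @^-1` A n : set RP).
  have [mA _] := Afin n.
  by rewrite -[X in measurable X]setTI; exact: measurable_curve_family.
rewrite (_ : setT = [set p : borel P | exists n,
    (0 < L (ysection (Gamma @^-1` A n : set RP) p))%E]).
  apply: finite_cover_of_integrals => // n.
    exact: measurable_fun_ysection.
  have [mA muA] := Afin n; apply: le_lt_trans (Gamma_le mA) _.
  have muAfin : mu (A n) \is a fin_num by rewrite ge0_fin_numE.
  by rewrite -(fineK muAfin) -EFinM ltry.
apply/seteqP; split=> // p _ /=; apply: contrapT => np.
have : {ae L, forall t : R, False}.
  apply: (@negligibleS _ _ _ _
    (\bigcup_n ysection (Gamma @^-1` A n : set RP) p)).
    move=> t _; have [n _ An] : (\bigcup_n A n) (Gamma (t, p)) by rewrite -AT.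
    by exists n => //; rewrite ysectionE.
  apply: negligible_bigcup => n; apply/negligibleP.
    exact: measurable_ysection.
  apply: contrapT => /eqP Ln; apply: np; exists n.
  by rewrite lt0e Ln measure_ge0.
by move=> /ae_meets_itv /(_ (@ltr01 R)) [].
Qed.

End curve_family.

Lemma L1dist_lty (R : realType) d (Y : measurableType d)
    (nu : {measure set Y -> \bar R}) (g h : LspaceType1 nu) :
  (L1dist g h < +oo)%E.
Proof.
have mg (k : LspaceType1 nu) : measurable_fun setT (k : Y -> R).
  exact: (@measurable_funPT _ _ _ _
    (repr (k : {mfun_ nu, Y >-> measurableTypeR R}))).
have fing (k : LspaceType1 nu) : ('N[nu]_1[EFin \o (k : Y -> R)] < +oo)%E.
  exact: (@Lebesgue_finite _ _ _ _ _ _ k).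
rewrite /L1dist.
pose h' : Y -> R := \- (h : Y -> R).
have mh' : measurable_fun setT h' by apply: measurableT_comp => //; exact: mg.
have -> : (fun y => (g y - h y)%:E) = EFin \o ((g : Y -> R) \+ h').
  by apply/funext.
apply: le_lt_trans (eminkowski _ (mg g) mh' (lexx _)) _.
rewrite lte_add_pinfty//.
rewrite (_ : EFin \o h' = \- (EFin \o (h : Y -> R)))%E//.
by rewrite oppe_Lnorm.
Qed.

(** * The equivalence *)

Theorem proposition3p5 (R : realType)
    (X : pmetricType R) (mu : {measure set (borel X) -> \bar R})
    (d : measure_display) (Y : measurableType d)
    (nu : {sigma_finite_measure set Y -> \bar R})
    (f : X -> LspaceType1 nu)
    (Sigma : {measure set (borel (Cut mu)) -> \bar R})
    (P : ptopologicalType) (pi : {measure set (borel P) -> \bar R})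
    (Gamma : R * P -> X) (C : R) :
  locally_compact [set: X] ->
  radon mu ->
  sigma_finite [set: borel X] mu ->
  L1loc_map mu f ->
  cut_measure Sigma ->
  associated f Sigma ->
  locally_compact [set: P] ->
  radon pi ->
  continuous Gamma ->
  (forall A : set (borel X), measurable A ->
    ((@lebesgue_measure R \x^ pi) (Gamma @^-1` A) <= C%:E * mu A)%E) ->
  {ae pi, forall p, geodesic (fun t : R => f (Gamma (t, p)))} <->
  {ae Sigma, forall E, Gamma_monotone pi Gamma (cut_set E)}.
Proof.
move=> _ rmu smu _ cS [Phi [mPhi PhiE] [Z Z0 ZE]] _ _ cG GC.
have Ssf := cut_measure_null_sigma_finite rmu smu cS.
have pisf : null_sigma_finite pi.
  apply: sigma_finite_null_sigma_finite.
  exact: (curve_family_sigma_finite cG GC smu).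
have aepi := ae_filter_ringOfSetsType pi.
have aeS := ae_filter_ringOfSetsType Sigma.
have mG := measurable_curve_family cG.
pose w (p : P) (z : borel (Cut mu) * R) := Phi (z.1, Gamma (z.2, p)).
have mw p : measurable_fun setT (w p).
  apply: (measurableT_comp mPhi); apply: measurable_fun_pair => //.
  exact: (measurableT_comp (measurable_curve cG p)).
have mray : measurable [set z : borel (Cut mu) * borel P |
    ray_like (fun t => w z.2 (z.1, t))].
  pose W (z : (borel (Cut mu) * borel P) * R) :=
    Phi (z.1.1, Gamma (z.2, z.1.2)).
  have mW : measurable_fun setT W.
    apply: (measurableT_comp mPhi); apply: measurable_fun_pair.
      exact: measurableT_comp.
    apply: (measurableT_comp mG); apply: measurable_fun_pair => //.
    exact: measurableT_comp.
  exact: measurable_ray_like mW.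
(* (i) and (ii) both say that E is a ray along the curve of p, for almost all
   E and p; they differ in the order of the quantifiers *)
have geodE : {ae pi, forall p, geodesic (fun t : R => f (Gamma (t, p)))} <->
    {ae pi, forall p, {ae Sigma, forall E, ray_like (fun t => w p (E, t))}}.
  have key : {ae pi, forall p, geodesic (fun t : R => f (Gamma (t, p))) <->
      {ae Sigma, forall E, ray_like (fun t => w p (E, t))}}.
    apply: filterS (ae_curve_family cG GC Z0) => p Zp.
    apply: (geodesic_ray_like Ssf (mw p) Zp).
      by move=> s t Zs Zt; rewrite /= ZE.
    by move=> s t; exact: L1dist_lty.
  by split=> h; apply: filterS2 key h => p [].
have monE : {ae Sigma, forall E, Gamma_monotone pi Gamma (cut_set E)} <->
    {ae Sigma, forall E, {ae pi, forall p, ray_like (fun t => w p (E, t))}}.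
  have key : {ae Sigma, forall E, Gamma_monotone pi Gamma (cut_set E) <->
      {ae pi, forall p, ray_like (fun t => w p (E, t))}}.
    apply: filterS PhiE => E PhiE.
    have aeE := ae_curve_family cG GC PhiE.
    pose c p t := Gamma (t, p) \in cut_set E.
    have cE p : [set t | c p t] = (fun t => Gamma (t, p)) @^-1` cut_set E.
      by apply/seteqP; split=> t /=; rewrite /c inE.
    split=> h; apply: filterS2 aeE h => p wc.
      move=> [_]; rewrite -cE => /monotone_set_ray_like; apply: ray_like_ae.
      by apply: filterS wc => t; rewrite /c /w /= => ->.
    move=> rw; split.
      rewrite -[X in measurable X]setTI.
      exact: (measurable_curve cG p) measurableT _ (measurable_cut_set E).
    by rewrite -cE; apply: ray_like_monotone_set; exact: ray_like_ae rw.
  by split=> h; apply: filterS2 key h => E [].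
apply: (iff_trans geodE); apply: iff_sym; apply: (iff_trans monE).
exact: ae_swap Ssf pisf mray.
Qed.
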